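(* Let $n$ be a positive integer and $r$ an integer with $r\geq\lceil n/\sqrt{3}\rceil+1$. Then the pulse $K(n,r)$ cannot terminate in the Aztec diamond $\mathrm{Az}(n)$, i.e., no finite sequence of firing moves from $K(n,r)$ reaches $\mathrm{Az}(n)$.
   Context: The grid complex is the tiling of the plane by unit squares (''faces''); two faces are adjacent if they share an edge, and $\mathrm{dist}(f,g)$ is the Manhattan distance between faces. A configuration $K$ assigns an integer weight $K_f$ to each face $f$, with finitely many nonzero weights; there is a marked face $f_0$ with $K_{f_0}=n$. Firing moves: (i) if $f,g$ are adjacent faces, both different from $f_0$, with $K_f\geq K_g+2$, one may fire $f$ towards $g$, decreasing $K_f$ by $1$ and increasing $K_g$ by $1$; (ii) if $g$ is adjacent to $f_0$ and $K_g<n$, one may fire from $f_0$ to $g$, increasing $K_g$ by $1$; (iii) if $g$ is adjacent to $f_0$ and $K_g>n$, one may fire from $g$ to $f_0$, decreasing $K_g$ by $1$; the weight of $f_0$ never changes. The pulse $K(n,r)$ has $K(n,r)_f=n$ if $\mathrm{dist}(f_0,f)\leq r$ and $0$ otherwise. The Aztec diamond $\mathrm{Az}(n)$ has $\mathrm{Az}(n)_{f_0}=n$ and $\mathrm{Az}(n)_f=\max\{n-\mathrm{dist}(f_0,f)+1,0\}$ for $f\neq f_0$. *)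

(* Defs.v *)
From Stdlib Require Export Relation_Operators.
From mathcomp Require Export all_boot all_order all_algebra finmap reals.
From mathcomp Require Import zify.
Set Implicit Arguments.
Unset Strict Implicit.
Unset Printing Implicit Defensive.
Import Order.TTheory GRing.Theory Num.Theory.
Local Open Scope ring_scope.

(* (i, j) stands for the unit square [i, i + 1] x [j, j + 1]. *)
Definition face : Type := (int * int)%type.

(* Two distinct unit squares share an edge iff they agree in one coordinate and
   differ by exactly one in the other. *)
Definition adjacent (f g : face) : bool :=
  ((f.1 == g.1) && (`|f.2 - g.2| == 1)) || ((f.2 == g.2) && (`|f.1 - g.1| == 1)).

Definition dist (f g : face) : int := `|f.1 - g.1| + `|f.2 - g.2|.

Definition config : Type := {fsfun face -> int with 0}.

(* One firing move, where n is the weight of the marked face f0. The weight of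
   f0 is not part of the conditions on moves and is never updated. *)
Inductive fires (f0 : face) (n : int) (K : config) : config -> Prop :=
| FireFaces (f g : face) :
    adjacent f g -> f != f0 -> g != f0 -> K g + 2 <= K f ->
    fires f0 n K [fsfun K with f |-> K f - 1, g |-> K g + 1]
| FireFromMarked (g : face) :
    adjacent g f0 -> K g < n -> fires f0 n K [fsfun K with g |-> K g + 1]
| FireToMarked (g : face) :
    adjacent g f0 -> n < K g -> fires f0 n K [fsfun K with g |-> K g - 1].

Definition reaches (f0 : face) (n : int) : config -> config -> Prop :=
  clos_refl_trans_1n config (fires f0 n).

Definition square (f0 : face) (m : nat) : seq face :=
  [seq (f0.1 - m%:Z + a%:Z, f0.2 - m%:Z + b%:Z)
  | a <- iota 0 (2 * m).+1, b <- iota 0 (2 * m).+1].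

(* The faces at distance at most r from f0, cut out of a finite square so as to
   have a finite set; the square loses nothing, see in_diamond. *)
Definition diamond (f0 : face) (r : int) : {fset face} :=
  [fset f in square f0 `|r|%N | dist f0 f <= r]%fset.

Definition pulse (f0 : face) (n r : int) : config :=
  [fsfun f in diamond f0 r => n].

(* The support is cut off at distance |n|, which loses nothing; see aztecE. *)
Definition aztec (f0 : face) (n : int) : config :=
  [fsfun f in diamond f0 `|n| =>
     if f == f0 then n else Num.max (n - dist f0 f + 1) 0].

Lemma mem_square (f0 : face) (m : nat) (f : face) :
  dist f0 f <= m%:Z -> f \in square f0 m.
Proof.
case: f0 f => u v [x y] fm; apply/allpairsP.
exists (`|(x - (u - m%:Z)%R)%R|%N, `|(y - (v - m%:Z)%R)%R|%N).
move: fm; rewrite /dist => fm; rewrite !mem_iota.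
by rewrite /= in fm *; split; [lia | lia | congr pair; lia].
Qed.

Lemma in_diamond (f0 : face) (r : int) (f : face) :
  (f \in diamond f0 r) = (dist f0 f <= r).
Proof.
rewrite in_fset; apply/andP/idP => [[] //|fr]; split=> //.
by apply: mem_square; apply: le_trans fr _; lia.
Qed.

Lemma pulseE (f0 : face) (n r : int) (f : face) :
  pulse f0 n r f = if dist f0 f <= r then n else 0.
Proof. by rewrite fsfunE in_diamond. Qed.

Lemma aztecE (f0 : face) (n : int) (f : face) :
  aztec f0 n f = if f == f0 then n else Num.max (n - dist f0 f + 1) 0.
Proof.
rewrite fsfunE in_diamond; case: ifP => //.
by case: eqP => [->|_]; rewrite /dist; lia.
Qed.

(* Main.v *)
(* The bound K <= n is preserved by every move, so no move towards f0 is ever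
   possible and the total weight never decreases. The Aztec diamond is the sum
   of the indicators of the balls of radius 1, ..., n around f0, and the ball
   of radius k has (k + 1)^2 + k^2 faces, so Az(n) has total weight
   n + 2 n (n + 1) (n + 2) / 3, which is less than the weight
   n (2 r^2 + 2 r + 1) of the pulse. *)
Require Import Defs.
From mathcomp Require Import all_boot all_order all_algebra finmap reals.
From mathcomp Require Import zify ring.
Import Order.TTheory GRing.Theory Num.Theory.
Local Open Scope ring_scope.

Definition mass (K : config) : int := \sum_(f <- finsupp K) K f.

Lemma mass_widen (K : config) (S : {fset face}) :
  (forall f, f \notin S -> K f = 0) -> mass K = \sum_(f <- S) K f.
Proof.
move=> KS; apply: big_fset_incl => [|f _]; last exact: fsfun_dflt.
apply/fsubsetP => f; rewrite mem_finsupp; apply: contraTT => /KS ->.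
by rewrite eqxx.
Qed.

Lemma mass_with (K : config) (g : face) (v : int) :
  mass [fsfun K with g |-> v] = mass K - K g + v.
Proof.
pose S := (g |` finsupp K)%fset.
have KS f : f \notin S -> K f = 0.
  by rewrite in_fset1U negb_or => /andP[_ /fsfun_dflt].
rewrite !(@mass_widen _ S) // => [|f fS]; last first.
  by rewrite fsfun_withE KS //; case: eqP fS => // ->; rewrite fset1U1.
rewrite !(big_fsetD1 g (fset1U1 _ _)) /= fsfun_with.
rewrite [\sum_(f <- _) _ in LHS](eq_big_seq K); first by ring.
by move=> f; rewrite in_fsetD1 fsfun_withE => /andP[/negbTE ->].
Qed.

(** When [f] fires towards [g], [K g + 1 <= K f - 1], so the bound survives. Firing from [f0]
    requires [K g < n], and the bound excludes firing towards [f0]. *)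
Lemma fires_bounded_mass (f0 : face) (n : int) (K K' : config) :
  fires f0 n K K' -> (forall f, K f <= n) ->
  (forall f, K' f <= n) /\ mass K <= mass K'.
Proof.
case=> [f g _ _ _ gf|g _ gn|g _ ng] Kn.
- have fg : f != g by apply: contraTneq gf => ->; lia.
  rewrite !mass_with fsfun_withE (negbTE fg); split=> [h|]; last by lia.
  by rewrite !fsfun_withE; have := Kn f; have := Kn h; do !case: eqP; lia.
- rewrite mass_with; split=> [h|]; last by lia.
  by rewrite fsfun_withE; have := Kn h; case: eqP; lia.
- by have := Kn g; lia.
Qed.

Lemma reaches_mass (f0 : face) (n : int) (K K' : config) :
  reaches f0 n K K' -> (forall f, K f <= n) -> mass K <= mass K'.
Proof.
elim=> // {}K K1 K2 KK1 _ IH Kn.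
by have [K1n /le_trans] := fires_bounded_mass _ _ _ _ KK1 Kn; apply; exact: IH.
Qed.

(* In the coordinates i + j and i - j the ball of radius k consists of the two
   square grids of points whose coordinates both have the parity of k, and of
   k - 1. *)
Lemma card_diamond (f0 : face) (k : nat) :
  #|` diamond f0 k| = (k.+1 ^ 2 + k ^ 2)%N.
Proof.
(* Relative to [f0], [h m a b] has coordinate sum [2a - m] and difference [2b - m]. *)
pose h m (a b : nat) : face :=
  (f0.1 + (a + b)%:Z - m%:Z, f0.2 + a%:Z - b%:Z).
pose grid c m := [seq h m a b | a <- iota 0 c, b <- iota 0 c].
have gridP c m f : reflect
    (exists a b : nat, [/\ (a < c)%N, (b < c)%N & f = h m a b])
    (f \in grid c m).
  apply: (iffP allpairsP) => [[[a b] /= []]|[a [b [ac bc ->]]]].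
    by rewrite !mem_iota /= => ac bc ->; exists a, b.
  by exists (a, b); rewrite !mem_iota.
have grid_uniq c m : uniq (grid c m).
  apply: allpairs_uniq; rewrite ?iota_uniq // => -[a b] [a' b'] _ _ /= [].
  by move=> e1 e2; congr pair; lia.
have size_grid c m : size (grid c m) = (c ^ 2)%N.
  by rewrite size_allpairs size_iota mulnn.
(* For [k = 0] the second grid is empty, so the truncation [0.-1 = 0] is harmless. *)
have -> : (k.+1 ^ 2 + k ^ 2)%N = size (grid k.+1 k ++ grid k k.-1).
  by rewrite size_cat !size_grid.
apply/perm_size/uniq_perm; first exact: fset_uniq.
  rewrite cat_uniq !grid_uniq andbT /=; apply/hasPn => f /gridP[a [b [ak bk ->]]].
  by apply/gridP => -[a' [b' [a'k b'k [e1 e2]]]]; lia.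
move=> f; rewrite in_diamond mem_cat; apply/idP/orP.
  move: f0 f @h @grid gridP {grid_uniq size_grid} => [u v] [x y] h grid gridP.
  rewrite /dist /= => xyk.
  (* The witnesses invert [h]. In the odd case neither the sum nor the difference can be [k] or
     [-k], so both fit in the smaller grid. *)
  have [e|o] := boolP (((x - u + (y - v) + k) %% 2)%Z == 0); [left|right].
  - apply/gridP; exists `|((x - u + (y - v) + k) %/ 2)%Z|%N.
    exists `|((x - u - (y - v) + k) %/ 2)%Z|%N.
    by rewrite /h /=; split; [lia | lia | congr pair; lia].
  - apply/gridP; exists `|((x - u + (y - v) + k - 1) %/ 2)%Z|%N.
    exists `|((x - u - (y - v) + k - 1) %/ 2)%Z|%N.
    by rewrite /h /=; split; [lia | lia | congr pair; lia].
by case=> /gridP[a [b [ak bk ->]]]; rewrite /dist /h /=; lia.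
Qed.

Lemma mass_pulse (f0 : face) (n : int) (r : nat) :
  mass (pulse f0 n r) = n * (r.+1 ^ 2 + r ^ 2)%N%:Z.
Proof.
rewrite (@mass_widen _ (diamond f0 r)) => [|f]; last first.
  by rewrite in_diamond pulseE => /negbTE ->.
rewrite (eq_big_seq (fun=> n)) => [|f]; last by rewrite in_diamond pulseE => ->.
by rewrite big_const_seq count_predT card_diamond iter_addr_0 -mulr_natr natz.
Qed.

(** Counts the radii 1, ..., [n] whose balls contain a face at distance [d]. Truncated subtraction
    provides the maximum with 0, and [0.-1 = 0] gives the weight [n] at the marked face. *)
Lemma sumz_nat_leq (d n : nat) :
  (n - d.-1)%N%:Z = \sum_(1 <= k < n.+1) (d%:Z <= k%:Z)%R%:Z.
Proof.
elim: n => [|n IH]; first by rewrite big_geq.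
by rewrite big_nat_recr //= -IH; case: (boolP (_ <= _)); lia.
Qed.

Lemma mass_aztec (f0 : face) (n : nat) :
  mass (aztec f0 n) = \sum_(1 <= k < n.+1) (k.+1 ^ 2 + k ^ 2)%N%:Z.
Proof.
rewrite (@mass_widen _ (diamond f0 n)) => [|f]; last first.
  by rewrite in_diamond aztecE; case: eqP => [->|_]; rewrite /dist; lia.
transitivity (\sum_(f <- diamond f0 n) \sum_(1 <= k < n.+1)
                 (dist f0 f <= k%:Z)%R%:Z).
  apply: eq_bigr => f _; rewrite aztecE.
  have -> : dist f0 f = `|dist f0 f|%N by rewrite /dist; lia.
  rewrite -sumz_nat_leq.
  case: eqP => [->|/eqP ff0]; first by rewrite /dist; lia.
  suff : `|dist f0 f|%N != 0%N by lia.
  by apply: contra ff0; case: f0 f => [u v] [x y]; rewrite /dist /eq_op /=; lia.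
(* Summing over faces first counts, for each [k], the ball of radius [k]. *)
rewrite exchange_big; apply: eq_big_nat => k /andP[_ kn].
rewrite -(card_diamond f0) -sum1_size (big_morph Posz PoszD (erefl _)) /=.
rewrite -(@big_fset_incl _ _ _ _ (diamond f0 k)) => [||f _].
- by apply: eq_big_seq => f; rewrite in_diamond => ->.
- by apply/fsubsetP => f; rewrite !in_diamond; lia.
- by rewrite in_diamond => /negbTE ->.
Qed.

Lemma sum_card_diamond (n : nat) :
  3 * \sum_(1 <= k < n.+1) (k.+1 ^ 2 + k ^ 2)%N%:Z =
  2 * n%:Z * (n%:Z + 1) * (n%:Z + 2) + 3 * n%:Z.
Proof.
elim: n => [|n IH]; first by rewrite big_geq.
by rewrite big_nat_recr //= mulrDr IH -!mulnn PoszD !PoszM !intS; ring.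
Qed.

Theorem theorem6p3 (R : realType) (f0 : face) (n r : int)
  (n_gt0 : 0 < n)
  (r_ge : Num.ceil (n%:~R / Num.sqrt (3 : R)) + 1 <= r) :
  ~ reaches f0 n (pulse f0 n r) (aztec f0 n).
Proof.
have n_le : n%:~R <= (r - 1)%:~R * Num.sqrt (3 : R).
  rewrite -ler_pdivrMr ?sqrtr_gt0 //.
  by apply: le_trans (ceil_ge _) _; rewrite ler_int lerBrDr.
have r_ge1 : 0 <= r - 1.
  rewrite -(ler_int R); have : 0 < n%:~R :> R by rewrite ltr0z.
  by move=> /lt_le_trans /(_ n_le); rewrite pmulr_lgt0 ?sqrtr_gt0 // => /ltW.
(* Squaring moves the hypothesis on [r] from the reals to the integers. *)
have n2_le : n ^+ 2 <= 3 * (r - 1) ^+ 2.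
  rewrite -(ler_int R) mulrC !intrM -!expr2 -[3%:~R]/(3 : R).
  rewrite -(@sqr_sqrtr R 3) // -exprMn lerXn2r //.
    by rewrite nnegrE ler0z; lia.
  by rewrite nnegrE mulr_ge0 ?ler0z ?sqrtr_ge0.
have [m nE] : exists m : nat, n = m by exists `|n|%N; lia.
have [s rE] : exists s : nat, r = s by exists `|r|%N; lia.
subst n r => /reaches_mass le_mass.
have {}le_mass : mass (pulse f0 m s) <= mass (aztec f0 m).
  by apply: le_mass => f; rewrite pulseE; case: ifP; lia.
move: (sum_card_diamond m) le_mass; rewrite mass_pulse -(mass_aztec f0).
rewrite -!mulnn PoszD !PoszM !intS; set M := mass _; clearbody M.
(* This follows from [m^2 <= 3 (s - 1)^2 <= (3 (s - 1))^2]. *)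
move=> M3 le_mass; have s_ge : m%:Z <= 3 * (s%:Z - 1) by nia.
have : 3 * (m%:Z * ((1 + s%:Z) * (1 + s%:Z) + s%:Z * s%:Z)) <= 3 * M by lia.
rewrite M3; apply/negP; rewrite -ltNge.
(* With [m] factored out, the comparison is termwise: [2 m^2 <= 6 (s - 1)^2], [6 m <= 18 (s - 1)]
   and [7 < 15]. *)
have -> : 2 * m%:Z * (m%:Z + 1) * (m%:Z + 2) + 3 * m%:Z =
          m%:Z * (2 * m%:Z ^+ 2 + 6 * m%:Z + 7) by ring.
have -> : 3 * (m%:Z * ((1 + s%:Z) * (1 + s%:Z) + s%:Z * s%:Z)) =
          m%:Z * (6 * (s%:Z - 1) ^+ 2 + 18 * (s%:Z - 1) + 15) by ring.
by rewrite ltr_pM2l //; lia.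
Qed.
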